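(* Let $\mu\in\mathbb C$, $\vec m,\vec m'\in\mathcal Z^n$, and let $\vec\Lambda\in\mathbb C^n$ be generic. Set $\lambda=\mu+\sum_{i=1}^n(\Lambda_i-2m_i)$ and $\lambda'=\mu+\sum_{i=1}^n(\Lambda_i-2m_i')$. Then for any $v\in M_{\lambda-1}$ and $v'\in M_{\lambda'-1}$, $$\big\langle\Phi_{\vec m}^{\vec\Lambda}(\lambda)v,\ \Phi_{\vec m'}^{\vec\Lambda}(\lambda')v'\big\rangle=\delta_{\vec m,\vec m'}\ \mathbb Q_{\vec m}^{\vec\Lambda}(\lambda)\ \langle v,v'\rangle ,$$ where the left-hand side uses the inner product on $M_{\mu-1}\otimes M^\star_{\Lambda_1}\otimes\dots\otimes M^\star_{\Lambda_n}$ and the right-hand side the inner product on $M_{\lambda-1}$.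
   Context: Fix $\eta\in\mathbb C$ with $\operatorname{Im}\eta>0$; $q^x=e^{\pi i\eta x}$, $[x]=\frac{q^x-q^{-x}}{q-q^{-1}}$, $[x]_k=[x][x+1]\cdots[x+k-1]$, $[k]!=[1]\cdots[k]$. $\mathcal Z^n=(\mathbb Z_{\ge0})^n$. ''Generic'' means outside a countable union of zero loci of holomorphic functions that are not identically zero. $\mathcal U_q(\mathfrak{sl}_2)$ is the unital algebra generated by $\mathbf E,\mathbf F,q^{x\mathbf h}$ ($x\in\mathbb C$) with $q^{x\mathbf h}q^{y\mathbf h}=q^{(x+y)\mathbf h}$, $q^{x\mathbf h}\mathbf E=q^{2x}\mathbf Eq^{x\mathbf h}$, $q^{x\mathbf h}\mathbf F=q^{-2x}\mathbf Fq^{x\mathbf h}$, $\mathbf{EF}-\mathbf{FE}=\frac{q^{\mathbf h}-q^{-\mathbf h}}{q-q^{-1}}$, and comultiplication $\Delta\mathbf E=\mathbf E\otimes1+q^{\mathbf h}\otimes\mathbf E$, $\Delta\mathbf F=\mathbf F\otimes q^{-\mathbf h}+1\otimes\mathbf F$, $\Delta q^{x\mathbf h}=q^{x\mathbf h}\otimes q^{x\mathbf h}$. $M_\lambda$ is the Verma module with highest weight vector $v_\lambda$ ($\mathbf Ev_\lambda=0$, $q^{x\mathbf h}v_\lambda=q^{\lambda x}v_\lambda$) and basis $v_\lambda^{(k)}=\mathbf F^kv_\lambda/[k]!$, $k\ge0$. $M_\Lambda^\star$ has basis $\{u_m^\Lambda\}_{m\ge0}$ (dual to $v^{(m)}_\Lambda$)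 with $\mathbf Eu_m^\Lambda=[m]u_{m-1}^\Lambda$, $q^{x\mathbf h}u_m^\Lambda=q^{(\Lambda-2m)x}u_m^\Lambda$, $\mathbf Fu_m^\Lambda=[\Lambda-m]u_{m+1}^\Lambda$. Holomorphic intertwining operators: $\Phi_m^\Lambda(\lambda):M_{\lambda-1}\to M_{\lambda-\Lambda+2m-1}\otimes M_\Lambda^\star$ is the $\mathcal U_q(\mathfrak{sl}_2)$-module map determined by $$\Phi_m^\Lambda(\lambda)v_{\lambda-1}=\sum_{i=0}^mq^{i(\lambda-\Lambda+2m-i)}[-\lambda+\Lambda-2m+i+1]_{m-i}\ v^{(i)}_{\lambda-\Lambda+2m-1}\otimes\mathbf E^iu_m^\Lambda .$$ For $\vec m\in\mathcal Z^n$, $\Phi_{\vec m}^{\vec\Lambda}(\lambda):M_{\lambda-1}\to M_{\lambda-1-\sum_i(\Lambda_i-2m_i)}\otimes M_{\Lambda_1}^\star\otimes\dots\otimes M_{\Lambda_n}^\star$ is the composition $$\Phi_{\vec m}^{\vec\Lambda}(\lambda)=\big(\Phi_{m_1}^{\Lambda_1}(\lambda-\textstyle\sum_{i=2}^n(\Lambda_i-2m_i))\otimes1^{n-1}\big)\cdots\big(\Phi_{m_{n-1}}^{\Lambda_{n-1}}(\lambda-\Lambda_n+2m_n)\otimes1\big)\,\Phi_{m_n}^{\Lambda_n}(\lambda).$$ Inner products (bilinear forms $\langle\cdot,\cdot\rangle$): on $M_\Lambda$, $\langle v_\Lambda^{(m)},v_\Lambda^{(m')}\rangle=\delta_{m,m'}q^{-m(\Lambda-m+1)}\frac{\prod_{k=1}^m[\Lambda-k+1]}{[m]!}$;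 on $M_\Lambda^\star$ (generic $\Lambda$), $\langle u_m^\Lambda,u_{m'}^\Lambda\rangle=\delta_{m,m'}q^{-m(\Lambda-m+1)}\frac{[m]!}{\prod_{k=1}^m[\Lambda-k+1]}$; on tensor products, the product form $\langle a\otimes b,a'\otimes b'\rangle=\langle a,a'\rangle\langle b,b'\rangle$. Dynamical Shapovalov coefficients: with $s_j=\sum_{i=j+1}^n(\Lambda_i-2m_i)$, $$\mathbb Q_{\vec m}^{\vec\Lambda}(\lambda)=\prod_{j=1}^n[m_j]!\prod_{k=1}^{m_j}\frac{[\lambda-s_j+k]\,[\lambda-s_j-\Lambda_j+2m_j-k]}{[\Lambda_j-k+1]} .$$ *)

(* Defs.v *)
From HB Require Import structures.
From mathcomp Require Import all_boot all_order all_algebra.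
From mathcomp Require Import all_classical all_reals all_analysis.
From mathcomp Require Import complex.
From mathcomp.multinomials Require Import freeg.
From mathcomp Require Import ring.

Set Implicit Arguments.
Unset Strict Implicit.
Unset Printing Implicit Defensive.

Import Order.TTheory GRing.Theory Num.Theory numFieldNormedType.Exports.
Local Open Scope classical_set_scope.
Local Open Scope complex_scope.
Local Open Scope ring_scope.

(* Spaces with a distinguished basis indexed by [I] are free modules
   [{freeg I / K}]; the basis vector of index [i] is [<< i >>], and [fglift f]
   is the linear extension of [f], defined on the basis. *)
Section FreeModules.
Context (K : comNzRingType).

Lemma fglift_is_linear (I : choiceType) (M : lmodType K) (f : I -> M) :
  linear (fglift f).
Proof.
have lift0 : fglift f 0 = 0.
  by have := lift_is_additive f 0 0; rewrite !subrr.
have liftN x : fglift f (- x) = - fglift f x.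
  by have := lift_is_additive f 0 x; rewrite lift0 !sub0r.
have liftD x y : fglift f (x + y) = fglift f x + fglift f y.
  by have := lift_is_additive f x (- y); rewrite liftN !opprK.
have liftS (r : seq I) (F : I -> {freeg I / K}) :
    fglift f (\sum_(z <- r) F z) = \sum_(z <- r) fglift f (F z).
  by elim: r => [|z r IH]; rewrite ?big_nil // !big_cons liftD IH.
move=> c x y; rewrite liftD; congr (_ + _).
rewrite -[x]freeg_sumE scaler_sumr !liftS scaler_sumr; apply: eq_bigr => z _.
have -> : c *: << coeff z x *g z >> = << (c * coeff z x) *g z >>
    :> {freeg I / K}.
  by apply/eqP/freeg_eqP => t; rewrite coeffZ !coeffU mulrA.
by rewrite !liftU scalerA.
Qed.

HB.instance Definition _ (I : choiceType) (M : lmodType K) (f : I -> M) :=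
  GRing.isLinear.Build K {freeg I / K} M *:%R (fglift f) (fglift_is_linear f).

Lemma freeg_lin_ext (I : choiceType) (M : lmodType K)
    (f g : {linear {freeg I / K} -> M}) :
  (forall i, f << i >> = g << i >>) -> f =1 g.
Proof.
move=> fg x; rewrite -[x]freeg_sumE !raddf_sum; apply: eq_bigr => i _ /=.
have -> : << coeff i x *g i >> = coeff i x *: << i >> :> {freeg I / K}.
  by apply/eqP/freeg_eqP => y; rewrite coeffZ !coeffU mul1r.
by rewrite !linearZ fg.
Qed.

(* The tensor product of the free modules on [I] and [J] is the free module on
   [I * J], with [<< i >> (x) << j >> = << (i, j) >>]. *)
Definition tens (I J : choiceType) (x : {freeg I / K}) (y : {freeg J / K}) :
    {freeg (I * J)%type / K} :=
  fglift (fun i => fglift (fun j => << (i, j) >>) y) x.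

Definition tensmap (I I' J J' : choiceType)
    (f : {freeg I / K} -> {freeg I' / K})
    (g : {freeg J / K} -> {freeg J' / K}) :
    {freeg (I * J)%type / K} -> {freeg (I' * J')%type / K} :=
  fglift (fun p : I * J => tens (f << p.1 >>) (g << p.2 >>)).

HB.instance Definition _ (I I' J J' : choiceType) f g :=
  GRing.Linear.copy (@tensmap I I' J J' f g)
    (fglift (fun p : I * J => tens (f << p.1 >>) (g << p.2 >>))).

Lemma fgliftE (I : choiceType) (M : lmodType K) (f : I -> M) x :
  fglift f x = \sum_(i <- dom x) coeff i x *: f i.
Proof.
rewrite -[in LHS](freeg_sumE x) linear_sum; apply: eq_bigr => i _.
by rewrite /= liftU.
Qed.

Lemma tens_linearl (I J : choiceType) (y : {freeg J / K}) :
  linear (fun x : {freeg I / K} => tens x y).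
Proof. by move=> c x x'; rewrite /tens linearP. Qed.

Lemma tens_linearr (I J : choiceType) (x : {freeg I / K}) :
  linear (fun y : {freeg J / K} => tens x y).
Proof.
move=> c y y'; rewrite /tens !fgliftE scaler_sumr -big_split /=.
by apply: eq_bigr => i _; rewrite linearP scalerDr !scalerA mulrC.
Qed.

HB.instance Definition _ (I J : choiceType) (x : {freeg I / K}) :=
  GRing.isLinear.Build K {freeg J / K} {freeg (I * J)%type / K} *:%R
    (tens x) (tens_linearr x).

Lemma tensDl (I J : choiceType) (x x' : {freeg I / K}) (y : {freeg J / K}) :
  tens (x + x') y = tens x y + tens x' y.
Proof. by rewrite /tens linearD. Qed.

Lemma tensZl (I J : choiceType) c (x : {freeg I / K}) (y : {freeg J / K}) :
  tens (c *: x) y = c *: tens x y.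
Proof. by rewrite /tens linearZ. Qed.

Lemma tensDr (I J : choiceType) (x : {freeg I / K}) (y y' : {freeg J / K}) :
  tens x (y + y') = tens x y + tens x y'.
Proof. exact: linearD. Qed.

Lemma tensZr (I J : choiceType) c (x : {freeg I / K}) (y : {freeg J / K}) :
  tens x (c *: y) = c *: tens x y.
Proof. exact: linearZ. Qed.

Lemma tensBl (I J : choiceType) (x x' : {freeg I / K}) (y : {freeg J / K}) :
  tens (x - x') y = tens x y - tens x' y.
Proof. by rewrite /tens linearB. Qed.

Lemma tensBr (I J : choiceType) (x : {freeg I / K}) (y y' : {freeg J / K}) :
  tens x (y - y') = tens x y - tens x y'.
Proof. exact: linearB. Qed.

Lemma tensU (I J : choiceType) (i : I) (j : J) :
  tens (<< i >> : {freeg I / K}) << j >> = << (i, j) >>.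
Proof. by rewrite /tens !liftU !scale1r. Qed.

Lemma tensmapE (I I' J J' : choiceType)
    (f : {linear {freeg I / K} -> {freeg I' / K}})
    (g : {linear {freeg J / K} -> {freeg J' / K}}) x y :
  tensmap f g (tens x y) = tens (f x) (g y).
Proof.
pose a y : {linear {freeg I / K} -> {freeg (I' * J')%type / K}} :=
  tensmap f g \o fglift (fun i => fglift (fun j => << (i, j) >>) y).
pose b y : {linear {freeg I / K} -> {freeg (I' * J')%type / K}} :=
  fglift (fun i => fglift (fun j => << (i, j) >>) (g y)) \o f.
apply: (freeg_lin_ext (f := a y) (g := b y)) => i.
rewrite /a /b /= -![fglift _ _]/(tens _ _).
apply: (freeg_lin_ext (f := tensmap f g \o tens << i >>)
  (g := tens (f << i >>) \o g)) => j /=.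
by rewrite tensU /tensmap liftU scale1r.
Qed.

(* The bilinear form with Gram matrix [g] in the distinguished basis. *)
Definition bilin (I : choiceType) (g : I -> I -> K) (x y : {freeg I / K}) : K :=
  \sum_(i <- dom x) \sum_(j <- dom y) coeff i x * coeff j y * g i j.

Definition gram_tens (I J : choiceType) (g : I -> I -> K) (h : J -> J -> K)
    (p p' : I * J) : K :=
  g p.1 p'.1 * h p.2 p'.2.

End FreeModules.

Section Uqsl2.
Context (R : realType) (eta : R[i]).
Local Notation C := R[i].

Definition cexp (z : C) : C :=
  let: x +i* y := z in (expR x * cos y) +i* (expR x * sin y).

Lemma cexpD (x y : C) : cexp (x + y) = cexp x * cexp y.
Proof.
case: x => a b; case: y => c d.
by apply/eqP; rewrite eq_complex /= expRD cosD sinD; apply/andP; split;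
  apply/eqP; ring.
Qed.

Lemma cexp0 : cexp 0 = 1.
Proof. by rewrite /cexp /= expR0 cos0 sin0 mulr1 mulr0. Qed.

(* [qpow x] is q^x, for q = exp (pi i eta). *)
Definition qpow (x : C) : C := cexp (pi%:C * 'i * eta * x).

Lemma qpowD x y : qpow (x + y) = qpow x * qpow y.
Proof. by rewrite /qpow mulrDr cexpD. Qed.

Lemma qpow0 : qpow 0 = 1.
Proof. by rewrite /qpow mulr0 cexp0. Qed.

Lemma qpowNK x : qpow (- x) * qpow x = 1.
Proof. by rewrite -qpowD addNr qpow0. Qed.

Definition qnum (x : C) : C := (qpow x - qpow (- x)) / (qpow 1 - (qpow 1)^-1).

Definition qpoch (x : C) (k : nat) : C := \prod_(i < k) qnum (x + i%:R).

Definition qfact (k : nat) : C := \prod_(1 <= i < k.+1) qnum i%:R.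

Lemma qnum0 : qnum 0 = 0.
Proof. by rewrite /qnum oppr0 subrr mul0r. Qed.

Lemma qpow_neq0 x : qpow x != 0.
Proof.
apply/eqP => q0; have := qpowNK x.
by rewrite q0 mulr0 => /eqP; rewrite eq_sym oner_eq0.
Qed.

Lemma qpowN x : qpow (- x) = (qpow x)^-1.
Proof. by apply: (mulIf (qpow_neq0 x)); rewrite qpowNK mulVf ?qpow_neq0. Qed.

Lemma qnum_comm (x y : C) :
  qnum (y + 1) * qnum (x - y) - qnum y * qnum (x - y + 1) =
  qnum (x - y *+ 2).
Proof.
rewrite /qnum mulr2n !opprD !opprK !qpowD !qpowN.
move: (qpow_neq0 y) (qpow_neq0 x) (qpow_neq0 1).
move: (qpow y) (qpow x) (qpow 1) => a b q a0 b0 q0.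
have [-> | d0] := eqVneq (q - q^-1) 0; first by rewrite !invr0 !mulr0 subrr.
have q2 : q * q - 1 != 0.
  apply: contraNneq d0 => q2.
  by rewrite -(mulKf q0 (q - _)) mulrBr divff // q2 mulr0.
by field; rewrite a0 b0 q0 q2.
Qed.

(* A left U_q(sl_2)-module structure on the free module with basis [I]: since
   U_q(sl_2) is given by generators and relations, this is the action of the
   generators E, F, q^{x h}, subject to the defining relations. *)
Record uqmod (I : choiceType) := UqMod {
  actE : {linear {freeg I / C} -> {freeg I / C}};
  actF : {linear {freeg I / C} -> {freeg I / C}};
  actK : C -> {linear {freeg I / C} -> {freeg I / C}};
  actKK : forall x y v, actK x (actK y v) = actK (x + y) v;
  actKE : forall x v, actK x (actE v) = qpow (2 * x) *: actE (actK x v);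
  actKF : forall x v, actK x (actF v) = qpow (- (2 * x)) *: actF (actK x v);
  actEF : forall v, actE (actF v) - actF (actE v) =
    (qpow 1 - (qpow 1)^-1)^-1 *: (actK 1 v - actK (- 1) v)
}.

Definition uq_hom (I J : choiceType) (A : uqmod I) (B : uqmod J)
    (f : {freeg I / C} -> {freeg J / C}) : Prop :=
  [/\ linear f,
      forall v, f (actE A v) = actE B (f v),
      forall v, f (actF A v) = actF B (f v)
    & forall x v, f (actK A x v) = actK B x (f v)].

Definition wtK (I : choiceType) (w : I -> C) (x : C) :
    {linear {freeg I / C} -> {freeg I / C}} :=
  fglift (fun i => qpow (w i * x) *: << i >>).

(* Verma module M_l, with basis << k >> = v_l^{(k)}. *)
Definition vermaE (l : C) : {linear {freeg nat / C} -> {freeg nat / C}} :=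
  fglift (fun k : nat =>
    if k is k'.+1 then qnum (l - k%:R + 1) *: << k' >> else 0).
Definition vermaF (l : C) : {linear {freeg nat / C} -> {freeg nat / C}} :=
  fglift (fun k : nat => qnum k.+1%:R *: << k.+1 >>).

(* M_l^*, with basis << m >> = u_m^l. *)
Definition dualE (l : C) : {linear {freeg nat / C} -> {freeg nat / C}} :=
  fglift (fun m : nat => qnum m%:R *: << m.-1 >>).
Definition dualF (l : C) : {linear {freeg nat / C} -> {freeg nat / C}} :=
  fglift (fun m : nat => qnum (l - m%:R) *: << m.+1 >>).

Definition wt (l : C) (k : nat) : C := l - 2 * k%:R.

Lemma fgliftU1 (I : choiceType) (M : lmodType C) (f : I -> M) i :
  fglift f << i >> = f i.
Proof. by rewrite liftU scale1r. Qed.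

Lemma wtKK (I : choiceType) (w : I -> C) x y v :
  wtK w x (wtK w y v) = wtK w (x + y) v.
Proof.
pose f : {linear {freeg I / C} -> {freeg I / C}} := wtK w x \o wtK w y.
apply: (freeg_lin_ext (f := f)) => i /=.
by rewrite !fgliftU1 linearZ /= fgliftU1 scalerA -qpowD mulrDr addrC.
Qed.

Lemma vermaKE l x v :
  wtK (wt l) x (vermaE l v) = qpow (2 * x) *: vermaE l (wtK (wt l) x v).
Proof.
apply: (freeg_lin_ext (f := wtK (wt l) x \o vermaE l)
  (g := qpow (2 * x) \*: (vermaE l \o wtK (wt l) x))) => -[|k] /=.
  by rewrite !fgliftU1 linear0 linearZ /= fgliftU1 !scaler0.
rewrite !fgliftU1 !linearZ /= !fgliftU1 !scalerA -qpowD mulrC.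
by congr (qpow _ * _ *: _); rewrite /wt -(natr1 k); ring.
Qed.

Lemma vermaKF l x v :
  wtK (wt l) x (vermaF l v) = qpow (- (2 * x)) *: vermaF l (wtK (wt l) x v).
Proof.
apply: (freeg_lin_ext (f := wtK (wt l) x \o vermaF l)
  (g := qpow (- (2 * x)) \*: (vermaF l \o wtK (wt l) x))) => k /=.
rewrite !fgliftU1 !linearZ /= !fgliftU1 !scalerA -qpowD mulrC.
by congr (qpow _ * _ *: _); rewrite /wt -(natr1 k) -[2 *: _]/(2 * _); ring.
Qed.

Lemma wtEF l k :
  (qpow 1 - (qpow 1)^-1)^-1 *:
    (wtK (wt l) 1 << k >> - wtK (wt l) (- 1) << k >>) =
  qnum (l - k%:R *+ 2) *: << k >> :> {freeg nat / C}.
Proof.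
rewrite /wtK /= !fgliftU1 -scalerBl scalerA mulrC /qnum /wt mulr1 mulrN1.
by rewrite mulr_natl.
Qed.

Lemma vermaEF l v : vermaE l (vermaF l v) - vermaF l (vermaE l v) =
  (qpow 1 - (qpow 1)^-1)^-1 *: (wtK (wt l) 1 v - wtK (wt l) (- 1) v).
Proof.
apply: (freeg_lin_ext (f := (vermaE l \o vermaF l) \- (vermaF l \o vermaE l))
  (g := (qpow 1 - (qpow 1)^-1)^-1 \*: (wtK (wt l) 1 \- wtK (wt l) (- 1)))).
move=> k /=; rewrite wtEF -qnum_comm !fgliftU1 linearZ /= fgliftU1 scalerA.
have -> : l - k.+1%:R + 1 = l - k%:R by rewrite -(natr1 k); ring.
rewrite natr1; case: k => [|k].
  by rewrite [fglift _ 0]linear0 !mulr0n qnum0 mul0r !subr0.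
rewrite linearZ /= fgliftU1 scalerA -scalerBl; congr (_ *: _).
by rewrite [qnum _%:R * qnum (_ + 1)]mulrC.
Qed.

Definition verma (l : C) : uqmod nat :=
  UqMod (wtKK (wt l)) (vermaKE l) (vermaKF l) (vermaEF l).

Lemma dualKE l x v :
  wtK (wt l) x (dualE l v) = qpow (2 * x) *: dualE l (wtK (wt l) x v).
Proof.
apply: (freeg_lin_ext (f := wtK (wt l) x \o dualE l)
  (g := qpow (2 * x) \*: (dualE l \o wtK (wt l) x))) => -[|k] /=.
  by rewrite !fgliftU1 !linearZ /= !fgliftU1 qnum0 !scale0r !scaler0.
rewrite !fgliftU1 !linearZ /= !fgliftU1 !scalerA -qpowD mulrC.
by congr (qpow _ * _ *: _); rewrite /wt -(natr1 k); ring.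
Qed.

Lemma dualKF l x v :
  wtK (wt l) x (dualF l v) = qpow (- (2 * x)) *: dualF l (wtK (wt l) x v).
Proof.
apply: (freeg_lin_ext (f := wtK (wt l) x \o dualF l)
  (g := qpow (- (2 * x)) \*: (dualF l \o wtK (wt l) x))) => k /=.
rewrite !fgliftU1 !linearZ /= !fgliftU1 !scalerA -qpowD mulrC.
by congr (qpow _ * _ *: _); rewrite /wt -(natr1 k) -[2 *: _]/(2 * _); ring.
Qed.

Lemma dualEF l v : dualE l (dualF l v) - dualF l (dualE l v) =
  (qpow 1 - (qpow 1)^-1)^-1 *: (wtK (wt l) 1 v - wtK (wt l) (- 1) v).
Proof.
apply: (freeg_lin_ext (f := (dualE l \o dualF l) \- (dualF l \o dualE l))
  (g := (qpow 1 - (qpow 1)^-1)^-1 \*: (wtK (wt l) 1 \- wtK (wt l) (- 1)))).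
move=> k /=; rewrite wtEF -qnum_comm !fgliftU1.
rewrite ![fglift _ (_ *: _)]linearZ /= !fgliftU1 !scalerA.
rewrite natr1 [qnum (l - _) * _]mulrC.
case: k => [|k]; first by rewrite !mulr0n qnum0 !mul0r !scale0r !subr0.
rewrite -scalerBl; congr ((_ - _ * qnum _) *: _).
by rewrite -(natr1 k) /=; ring.
Qed.

Definition dualverma (l : C) : uqmod nat :=
  UqMod (wtKK (wt l)) (dualKE l) (dualKF l) (dualEF l).

(* The Verma module is generated by << 0 >> and << k >> = F^k << 0 >> / [k]!. *)
Lemma verma_hw l : actE (verma l) << 0%N >> = 0 /\
  forall x, actK (verma l) x << 0%N >> = qpow (l * x) *: << 0%N >>.
Proof.
split=> [|x] /=; rewrite fgliftU1 //.
by rewrite /wt mulr0 subr0.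
Qed.

Lemma verma_basis l k :
  iter k (actF (verma l)) << 0%N >> = qfact k *: << k >>.
Proof.
elim: k => [|k IH]; first by rewrite /qfact big_geq // scale1r.
rewrite iterS IH linearZ /= fgliftU1 scalerA.
by rewrite /qfact [in RHS]big_nat_recr.
Qed.

Section Tensor.
Context (I J : choiceType) (A : uqmod I) (B : uqmod J).
Local Notation V := {freeg (I * J)%type / C}.

(* Comultiplication: E |-> E (x) 1 + q^h (x) E, F |-> F (x) q^{-h} + 1 (x) F,
   q^{xh} |-> q^{xh} (x) q^{xh}. *)
Definition tensE : {linear V -> V} :=
  tensmap (actE A) idfun \+ tensmap (actK A 1) (actE B).
Definition tensF : {linear V -> V} :=
  tensmap (actF A) (actK B (- 1)) \+ tensmap idfun (actF B).
Definition tensK (x : C) : {linear V -> V} := tensmap (actK A x) (actK B x).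

Lemma tensEt x y :
  tensE (tens x y) = tens (actE A x) y + tens (actK A 1 x) (actE B y).
Proof. by rewrite /tensE /= !tensmapE. Qed.

Lemma tensFt x y :
  tensF (tens x y) = tens (actF A x) (actK B (- 1) y) + tens x (actF B y).
Proof. by rewrite /tensF /= !tensmapE. Qed.

Lemma tensKt z x y : tensK z (tens x y) = tens (actK A z x) (actK B z y).
Proof. by rewrite /tensK /= tensmapE. Qed.

Lemma tensKK x y v : tensK x (tensK y v) = tensK (x + y) v.
Proof.
apply: (freeg_lin_ext (f := tensK x \o tensK y) (g := tensK (x + y))).
by case=> i j; rewrite -tensU -[LHS]/(tensK x (tensK y _)) !tensKt !actKK.
Qed.

Lemma tensKE x v : tensK x (tensE v) = qpow (2 * x) *: tensE (tensK x v).
Proof.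
apply: (freeg_lin_ext (f := tensK x \o tensE)
  (g := qpow (2 * x) \*: (tensE \o tensK x))).
case=> i j; rewrite -tensU -[LHS]/(tensK x (tensE _)).
rewrite -[RHS]/(qpow (2 * x) *: tensE (tensK x _)) tensKt !tensEt.
rewrite linearD !tensKt.
by rewrite !actKE !actKK [x + 1]addrC tensZl tensZr scalerDr.
Qed.

Lemma tensKF x v : tensK x (tensF v) = qpow (- (2 * x)) *: tensF (tensK x v).
Proof.
apply: (freeg_lin_ext (f := tensK x \o tensF)
  (g := qpow (- (2 * x)) \*: (tensF \o tensK x))).
case=> i j; rewrite -tensU -[LHS]/(tensK x (tensF _)).
rewrite -[RHS]/(qpow (- (2 * x)) *: tensF (tensK x _)) tensKt !tensFt.
rewrite linearD !tensKt.
by rewrite !actKF !actKK [x + -1]addrC tensZl tensZr scalerDr.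
Qed.

Lemma tensEF v : tensE (tensF v) - tensF (tensE v) =
  (qpow 1 - (qpow 1)^-1)^-1 *: (tensK 1 v - tensK (- 1) v).
Proof.
apply: (freeg_lin_ext (f := (tensE \o tensF) \- (tensF \o tensE))
  (g := (qpow 1 - (qpow 1)^-1)^-1 \*: (tensK 1 \- tensK (- 1)))).
case=> i j; rewrite -tensU.
rewrite -[LHS]/(tensE (tensF _) - tensF (tensE _)).
rewrite -[RHS]/(_ *: (tensK 1 _ - tensK (- 1) _)) !tensKt tensFt tensEt.
rewrite [tensE (_ + _)]linearD [tensF (_ + _)]linearD !tensEt !tensFt.
have EFx : actE A (actF A << i >>) = actF A (actE A << i >>) +
    (qpow 1 - (qpow 1)^-1)^-1 *: (actK A 1 << i >> - actK A (- 1) << i >>).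
  by rewrite -actEF addrC subrK.
have EFy : actE B (actF B << j >>) = actF B (actE B << j >>) +
    (qpow 1 - (qpow 1)^-1)^-1 *: (actK B 1 << j >> - actK B (- 1) << j >>).
  by rewrite -actEF addrC subrK.
rewrite EFx EFy actKE actKF tensZl tensZr mulrN1 mulr1.
rewrite !tensDl !tensDr tensZl tensZr tensBl tensBr.
apply/eqP; rewrite subr_eq; apply/eqP.
set a := tens (actF A (actE A _)) _; set p := qpow _ *: _.
set r := tens (actE A _) _; set d := tens (actK A 1 _) (actF B _).
set c := _^-1; set s := tens _ (actK B 1 _); set t := tens _ (actK B (- 1) _).
set u := tens (actK A (- 1) _) _; rewrite !addrA.
rewrite [LHS](ACl (2*6*1*4*3*5)) /= -scalerDr.
by congr (_ *: _ + _ + _ + _ + _); rewrite addrC addrA subrK.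
Qed.

Definition tensor : uqmod (I * J)%type := UqMod tensKK tensKE tensKF tensEF.

End Tensor.

Definition holo_intw_spec (L : C) (m : nat) (l : C)
    (f : {freeg nat / C} -> {freeg (nat * nat)%type / C}) : Prop :=
  uq_hom (verma (l - 1)) (tensor (verma (l - L + 2 * m%:R - 1)) (dualverma L)) f
  /\ f << 0%N >> = \sum_(i < m.+1)
       (qpow (i%:R * (l - L + 2 * m%:R - i%:R)) *
        qpoch (- l + L - 2 * m%:R + i%:R + 1) (m - i)) *:
       tens << val i >> (iter i (actE (dualverma L)) << m >>).

(* The module map Phi_m^L(l) determined by its value on the highest weight
   vector; [xget] picks the map satisfying the specification (and would return
   the zero map if there were none). *)
Definition Phi1 (L : C) (m : nat) (l : C) :
    {freeg nat / C} -> {freeg (nat * nat)%type / C} :=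
  xget (fun=> 0) [set f | holo_intw_spec L m l f].

(* Basis of M (x) M_{L_1}^* (x) ... (x) M_{L_n}^*, bracketed to the left. *)
Fixpoint tidx (n : nat) : choiceType :=
  if n is n'.+1 then (tidx n' * nat)%type : choiceType else nat : choiceType.

Definition initf (T : Type) (n : nat) (f : 'I_n.+1 -> T) (i : 'I_n) : T :=
  f (widen_ord (leqnSn n) i).

(* Phi_{m_1..m_n}(l) = (Phi_{m_1..m_{n-1}}(l - L_n + 2 m_n) (x) 1) Phi_{m_n}(l),
   which unfolds to the composition over j of the
   Phi_{m_j}(l - sum_(i > j) (L_i - 2 m_i)) (x) 1^{n-j}. *)
Fixpoint Phi (n : nat) :
    ('I_n -> C) -> ('I_n -> nat) -> C ->
    {freeg nat / C} -> {freeg (tidx n) / C} :=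
  match n with
  | 0 => fun _ _ _ v => v
  | n'.+1 => fun L m l v =>
      tensmap (Phi (initf L) (initf m) (l - L ord_max + 2 * (m ord_max)%:R))
        idfun (Phi1 (L ord_max) (m ord_max) l v)
  end.

Definition gram_verma (L : C) (m m' : nat) : C :=
  (m == m')%:R * (qpow (- (m%:R * (L - m%:R + 1))) *
    ((\prod_(1 <= k < m.+1) qnum (L - k%:R + 1)) / qfact m)).

Definition gram_dual (L : C) (m m' : nat) : C :=
  (m == m')%:R * (qpow (- (m%:R * (L - m%:R + 1))) *
    (qfact m / \prod_(1 <= k < m.+1) qnum (L - k%:R + 1))).

(* Product form on M_l (x) M_{L_1}^* (x) ... (x) M_{L_n}^*. *)
Fixpoint gram_prod (l : C) (n : nat) : ('I_n -> C) -> tidx n -> tidx n -> C :=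
  match n with
  | 0 => fun _ => gram_verma l
  | n'.+1 => fun L => gram_tens (gram_prod l (initf L)) (gram_dual (L ord_max))
  end.

Definition dyn_shapovalov (n : nat) (L : 'I_n -> C) (m : 'I_n -> nat) (l : C) :
    C :=
  \prod_(j < n)
    let s := \sum_(i < n | (j < i)%N) (L i - 2 * (m i)%:R) in
    qfact (m j) * \prod_(1 <= k < (m j).+1)
      (qnum (l - s + k%:R) * qnum (l - s - L j + 2 * (m j)%:R - k%:R) /
       qnum (L j - k%:R + 1)).

End Uqsl2.

Definition holomorphic (R : realType) (n : nat) (f : 'rV[R[i]]_n -> R[i]) :=
  forall x : 'rV[R[i]^o]_n, differentiable (f : 'rV[R[i]^o]_n -> R[i]^o) x.

(* [P] holds outside a countable union of zero loci of holomorphic functions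
   that are not identically zero. *)
Definition generically (R : realType) (n : nat) (P : 'rV[R[i]]_n -> Prop) :=
  exists f : nat -> 'rV[R[i]]_n -> R[i],
    (forall k, holomorphic (f k) /\ exists x, f k x <> 0) /\
    forall x, (forall k, f k x <> 0) -> P x.

(* Main.v *)
Require Import Defs.
From mathcomp Require Import all_boot all_order all_algebra.
From mathcomp Require Import all_classical all_reals all_analysis.
From mathcomp Require Import complex.
From mathcomp.multinomials Require Import freeg.
From mathcomp Require Import ring lra.

(** The proof rests on contravariance.  All the forms involved satisfy
    <F x, y> = <x, q^{-h} E y>: this is a one-line recursion for the Gram matrix
    of a Verma module and of its dual ([verma_contravariant],
    [dual_contravariant]), and the comultiplication is exactly such that the
    property passes to tensor products ([tensor_contravariant]).  Hence, for two
    module maps f : M_l -> A and f' : M_l' -> A into a module with a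
    contravariant form, <f v, f' v'> obeys the recursion that determines the
    form of M_l' from its value at highest weight vectors, so that
    <f v, f' v'> = <f v_l, f' v_l'> <v, v'> ([verma_hom_form]).

    For n = 1 it remains to pair two highest weight vectors, which are explicit.
    Their components lie on (i, m - i) and (i, m' - i), so they are orthogonal
    unless m = m'; if m = m', the sum over i is an instance of the
    q-Chu-Vandermonde identity ([q_vandermonde]), whose closed form is the
    dynamical Shapovalov coefficient ([intw_hw_norm]).

    For general n the last factor splits off: Phi is (Phi' (x) 1) Phi_{m_n}.  By
    induction Phi' multiplies the form by a Kronecker delta times a Shapovalov
    coefficient, and what is left is the case n = 1 for Phi_{m_n}
    ([Phi_form]).

    The operators are specified by the value on the highest weight vector, so
    their existence has to be established: that value is annihilated by E
    ([actE_intw_hw]), and Im eta > 0 makes every [k]! invertible, so that the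
    Verma module has its universal property ([verma_lift_hom]).

    Genericity of Lambda is only used to invert the numbers [Lambda_j - k],
    k >= 0.  For each k the product over j of these is holomorphic in Lambda,
    because the exponential is ([holomorphic_cexp]), and it equals 1 at
    Lambda_j = k + 1. *)

Set Implicit Arguments.
Unset Strict Implicit.
Unset Printing Implicit Defensive.

Import Order.TTheory GRing.Theory Num.Theory numFieldNormedType.Exports.
Local Open Scope ring_scope.

(** * The complex exponential is holomorphic *)

(** The derivative at 0 in epsilon-delta form, so that the bounds for exp, cos
    and sin can be multiplied together. *)
Lemma first_order_bound (R : realType) (f : R -> R) (d e : R) :
  is_derive (0 : R) 1 f d -> 0 < e ->
  exists2 r : R, 0 < r & forall x, `|x| < r -> `|f x - f 0 - d * x| <= e * `|x|.
Proof.
move=> [df <-] e0.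
have := df; rewrite /derivable -/(derive f 0 1) => /cvg_ex[l hl].
have dl : 'D_1 f 0 = l by rewrite /derive; apply/cvg_lim.
rewrite dl.
move/cvgrPdist_le : hl => /(_ _ e0).
rewrite near_withinE => /nbhs_norm0P[r /= r0 hr].
exists r => // x xr.
have [->|x0] := eqVneq x 0; first by rewrite subrr mulr0 subrr normr0 mulr0.
have := hr x xr x0; rewrite /= addr0 [x *: 1]mulr1 => h.
have -> : f x - f 0 - l * x = - (l - x^-1 * (f x - f 0)) * x by field.
by rewrite normrM normrN ler_wpM2r.
Qed.

Lemma normc_le_add (R : realType) (h : R[i]) :
  `|h| <= (`|complex.Re h| + `|complex.Im h|)%:C%C.
Proof.
rewrite [X in `|X|]complexE (le_trans (ler_normD _ _)) // normrM.
rewrite !normc_def /= !expr0n /= !addr0 !sqrtr_sqr expr1n add0r sqrtr1 mul1r.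
by rewrite -rmorphD /= lecR.
Qed.

Lemma normc_Re_Im (R : realType) (h : R[i]) (r : R) : `|h| <= r%:C%C ->
  `|complex.Re h| <= r /\ `|complex.Im h| <= r.
Proof.
move=> hr; split; rewrite -lecR; last rewrite -normrN -ReiNIm;
  apply: le_trans (normc_ge_Re _) _ => //.
by rewrite normrM [X in _ * X](_ : _ = 1) ?mulr1 //
  normc_def /= expr0n expr1n add0r sqrtr1.
Qed.

(** For h = x + iy the two components of exp h - 1 - h are
    e^x cos y - 1 - x = (e^x - 1 - x) cos y + (1 + x) (cos y - 1) and
    e^x sin y - y = (e^x - 1) sin y + (sin y - y), where every product has a
    factor that is o(h) or two factors that are O(h). *)
Lemma cexp_first_order (R : realType) (e : R) : 0 < e ->
  exists2 r : R, 0 < r &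
    forall h : R[i], `|h| < r%:C%C -> `|cexp h - 1 - h| <= e%:C%C * `|h|.
Proof.
(* The real and imaginary parts come out at most 3 d |h| and 5 d |h|. *)
move=> e0; pose d := Num.min (e / 8) 1.
have d0 : 0 < d by rewrite lt_min ltr01 divr_gt0.
have d1 : d <= 1 by rewrite ge_min lexx orbT.
have de : d * 8 <= e by rewrite -ler_pdivlMr // ge_min lexx.
clearbody d; have := first_order_bound (is_derive_expR 0) d0.
have := first_order_bound (is_derive_sin 0) d0.
have := first_order_bound (is_derive_cos 0) d0.
rewrite expR0 sin0 cos0 => -[r1 r10 h1] [r2 r20 h2] [r3 r30 h3].
exists (Num.min (Num.min r1 r2) (Num.min r3 d)).
  by rewrite !lt_min r10 r20 r30 d0.
move=> h hr; have nh := normc_def h.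
move: (lexx `|h|); rewrite {2}nh => /normc_Re_Im; set N := Num.sqrt _ in nh *.
have N0 : 0 <= N by rewrite sqrtr_ge0.
clearbody N.
move: hr; rewrite nh ltcR -rmorphM /= !lt_min => /andP[/andP[N1 N2] /andP[N3 Nd]].
case: h nh => x y /= nh [xN yN].
move: (h3 _ (le_lt_trans xN N3)) (h1 _ (le_lt_trans yN N1)) (h2 _ (le_lt_trans yN N2)).
rewrite ?oppr0 ?mul0r ?subr0 ?mul1r ?addr0.
move=> E K S.
have [c1 s1] : `|cos y| <= 1 /\ `|sin y| <= 1 by rewrite cos_max sin_max.
apply: le_trans (normc_le_add _) _ => /=; rewrite lecR oppr0 addr0.
have dN : d * `|x| <= d * N /\ d * `|y| <= d * N by rewrite !ler_pM2l.
case: dN => dx dy.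
have A : `|expR x * cos y - 1 - x| <= 3 * d * N.
  have -> : expR x * cos y - 1 - x =
      (expR x - 1 - x) * cos y + (1 + x) * (cos y - 1) by ring.
  apply: le_trans (ler_normD _ _) _; rewrite !normrM.
  have : `|1 + x| <= 2 by move: (ler_normD 1 x); rewrite normr1; lra.
  move: (normr_ge0 (expR x - 1 - x)) (normr_ge0 (cos y - 1)) => p1 p2.
  move=> /(ler_wpM2r p2) q2; move: c1 => /(ler_wpM2l p1) q1; lra.
have B : `|expR x * sin y - y| <= 5 * d * N.
  have -> : expR x * sin y - y = (expR x - 1) * sin y + (sin y - y) by ring.
  apply: le_trans (ler_normD _ _) _; rewrite !normrM.
  have e2 : `|expR x - 1| <= 2 * N.
    have -> : expR x - 1 = (expR x - 1 - x) + x by ring.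
    apply: le_trans (ler_normD _ _) _.
    have : d * N <= N by rewrite ler_piMl. lra.
  have s2 : `|sin y| <= 2 * N.
    have -> : sin y = (sin y - y) + y by ring.
    apply: le_trans (ler_normD _ _) _.
    have : d * N <= N by rewrite ler_piMl. lra.
  have := ler_pM (normr_ge0 _) (normr_ge0 _) e2 s2.
  have : N * N <= d * N by rewrite ler_wpM2r // ltW. lra.
have : 8 * d * N <= e * N by rewrite ler_wpM2r // mulrC.
lra.
Qed.

Lemma norm_quotient_le (K : numFieldType) (a h e : K) :
  h != 0 -> `|a| <= e * `|h| -> `|a / h| <= e.
Proof. by move=> h0 ah; rewrite normrM normfV ler_pdivrMr ?normr_gt0. Qed.

(** Since exp (z + h) - exp z = exp z (exp h - 1), only the expansion of exp at 0
    is needed. *)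
Lemma cexp_derivable (R : realType) (z : R[i]) :
  derivable (@cexp R : R[i]^o -> R[i]^o) z 1.
Proof.
apply/cvg_ex; exists (cexp z).
apply/cvgrPdist_le => /= e e0.
have eC : e = (complex.Re e)%:C%C by rewrite RRe_real // gtr0_real.
have e1 : 0 < complex.Re e by rewrite eC ltcR in e0.
rewrite near_withinE. apply/(@nbhs_norm0P _ (R[i]^o : normedModType R[i])).
(* |exp z| + 1, rather than |exp z|, bounds the factor exp z: it is
   visibly nonzero. *)
have c0 : 0 < Num.sqrt (complex.Re (cexp z) ^+ 2 + complex.Im (cexp z) ^+ 2) + 1.
  by rewrite ltr_wpDl // sqrtr_ge0.
have [r r0 hr] := cexp_first_order (divr_gt0 e1 c0).
exists r%:C%C => /= [|h]; first by rewrite ltcR.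
move=> hh h0; rewrite [_ *: 1]mulr1 cexpD.
rewrite [_ *: _]/(h^-1 * _).
have -> : cexp z - h^-1 * (cexp h * cexp z - cexp z) =
    - (cexp z * (cexp h - 1 - h)) / h.
  by field.
rewrite mulNr normrN; apply: norm_quotient_le => //; rewrite normrM.
apply: le_trans (ler_wpM2l (normr_ge0 _) (hr h hh)) _.
rewrite mulrA ler_wpM2r // eC normc_def -rmorphM /= lecR.
by rewrite mulrCA ler_piMr ?(ltW e1) // ler_pdivrMr // mul1r lerDl.
Qed.

Lemma holomorphic_cexp (R : realType) (n : nat) (i : 'I_n) (a b : R[i]) :
  holomorphic (fun x : 'rV[R[i]]_n => cexp (a * x ord0 i + b)).
Proof.
move=> x.
apply: (@differentiable_comp _ _ _ _
  (fun x : 'rV[R[i]^o]_n => a * x ord0 i + b : R[i]^o)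
  (@cexp R : R[i]^o -> R[i]^o)).
  apply: differentiableD => //; apply: differentiableM => //.
  exact: differentiable_coord.
by apply/derivable1_diffP; exact: cexp_derivable.
Qed.

(** * Bilinear forms on free modules *)

Section Bilin.
Context (K : comNzRingType).
Implicit Types I J : choiceType.

Lemma bilin_fglift I (g : I -> I -> K) (x y : {freeg I / K}) :
  bilin g x y = fglift (fun i => fglift (fun j => g i j : K^o) y) x.
Proof.
rewrite fgliftE; apply: eq_bigr => i _; rewrite fgliftE scaler_sumr.
by apply: eq_bigr => j _; rewrite /GRing.scale /= mulrA.
Qed.

(** [bilinl] and [bilinr] are the form with one argument fixed, as linear maps:
    they bring the generic lemmas on linear maps to bear on [bilin]. *)
Definition bilinl I (g : I -> I -> K) (y : {freeg I / K}) :
    {linear {freeg I / K} -> K^o} :=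
  fglift (fun i => fglift (fun j => g i j : K^o) y).

Definition bilinr I (g : I -> I -> K) (x : {freeg I / K}) :
    {linear {freeg I / K} -> K^o} :=
  fglift (fun j => fglift (fun i => g i j : K^o) x).

Lemma bilinlE I (g : I -> I -> K) x y : bilin g x y = bilinl g y x.
Proof. exact: bilin_fglift. Qed.

Lemma bilinC I (g : I -> I -> K) x y : bilin g x y = bilin (fun i j => g j i) y x.
Proof.
rewrite /bilin exchange_big; apply: eq_bigr => j _; apply: eq_bigr => i _.
by rewrite [coeff _ x * _]mulrC.
Qed.

Lemma bilinrE I (g : I -> I -> K) x y : bilin g x y = bilinr g x y.
Proof. by rewrite bilinC bilin_fglift. Qed.

Lemma bilinU I (g : I -> I -> K) i j : bilin g << i >> << j >> = g i j.
Proof. by rewrite bilin_fglift !liftU !scale1r. Qed.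

Lemma bilinDl I (g : I -> I -> K) x x' y :
  bilin g (x + x') y = bilin g x y + bilin g x' y.
Proof. by rewrite !bilinlE linearD. Qed.

Lemma bilinDr I (g : I -> I -> K) x y y' :
  bilin g x (y + y') = bilin g x y + bilin g x y'.
Proof. by rewrite !bilinrE linearD. Qed.

Lemma bilinZl I (g : I -> I -> K) c x y : bilin g (c *: x) y = c * bilin g x y.
Proof. by rewrite !bilinlE linearZ. Qed.

Lemma bilinZr I (g : I -> I -> K) c x y : bilin g x (c *: y) = c * bilin g x y.
Proof. by rewrite !bilinrE linearZ. Qed.

Lemma bilin0l I (g : I -> I -> K) y : bilin g 0 y = 0.
Proof. by rewrite bilinlE linear0. Qed.

Lemma bilin0r I (g : I -> I -> K) x : bilin g x 0 = 0.
Proof. by rewrite bilinrE linear0. Qed.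

Lemma bilin_suml I (g : I -> I -> K) (T : Type) (r : seq T) (P : pred T) F y :
  bilin g (\sum_(t <- r | P t) F t) y = \sum_(t <- r | P t) bilin g (F t) y.
Proof. by rewrite bilinlE linear_sum; apply: eq_bigr => t _; rewrite bilinlE. Qed.

Lemma bilin_sumr I (g : I -> I -> K) (T : Type) (r : seq T) (P : pred T) F x :
  bilin g x (\sum_(t <- r | P t) F t) = \sum_(t <- r | P t) bilin g x (F t).
Proof. by rewrite bilinrE linear_sum; apply: eq_bigr => t _; rewrite bilinrE. Qed.

Lemma freeg_span I (P : {freeg I / K} -> Prop) :
  P 0 -> (forall c x y, P x -> P y -> P (c *: x + y)) ->
  (forall i, P << i >>) -> forall x, P x.
Proof.
move=> P0 PD PU x; rewrite -[x]freeg_sumE.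
elim/big_rec: _ => // i y _ Py.
have -> : << coeff i x *g i >> = coeff i x *: << i >> :> {freeg I / K}.
  by apply/eqP/freeg_eqP => j; rewrite coeffZ !coeffU mul1r.
exact: PD.
Qed.

(** With two of the maps equal to the identity this checks adjointness on basis
    vectors; with [f3] and [f4] equal to the identity it computes the pullback of
    a form along a pair of maps. *)
Lemma bilin_eq_basis I I' J J' (g : I -> I -> K) (h : J -> J -> K) c
    (f1 : {freeg I' / K} -> {freeg I / K}) (f2 : {freeg J' / K} -> {freeg I / K})
    (f3 : {freeg I' / K} -> {freeg J / K}) (f4 : {freeg J' / K} -> {freeg J / K}) :
  linear f1 -> linear f2 -> linear f3 -> linear f4 ->
  (forall i j, bilin g (f1 << i >>) (f2 << j >>) =
     c * bilin h (f3 << i >>) (f4 << j >>)) ->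
  forall x y, bilin g (f1 x) (f2 y) = c * bilin h (f3 x) (f4 y).
Proof.
move=> l1 l2 l3 l4 gh x y.
have lin0 (A B : lmodType K) (f : A -> B) : linear f -> f 0 = 0.
  move=> lf; have := lf (-1) 0 0; rewrite scaler0 addr0.
  by rewrite scaleN1r addNr.
elim/freeg_span: x y => [|a x x' Hx Hx'|i] y.
- by rewrite !lin0 // !bilin0l mulr0.
- rewrite l1 l3 !bilinDl !bilinZl Hx Hx'; ring.
elim/freeg_span: y => [|a y y' Hy Hy'|j] //.
- by rewrite !(lin0 _ _ f2, lin0 _ _ f4) // !bilin0r mulr0.
- rewrite l2 l4 !bilinDr !bilinZr Hy Hy'; ring.
Qed.

Lemma bilin_tens I J (g : I -> I -> K) (h : J -> J -> K) x x' y y' :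
  bilin (gram_tens g h) (tens x y) (tens x' y') = bilin g x x' * bilin h y y'.
Proof.
elim/freeg_span: x => [|c a b Ha Hb|i].
- by rewrite bilin0l /tens linear0 bilin0l mul0r.
- rewrite tensDl tensZl !bilinDl !bilinZl Ha Hb; ring.
elim/freeg_span: y => [|c a b Ha Hb|j].
- by rewrite bilin0l linear0 bilin0l mulr0.
- rewrite tensDr tensZr !bilinDl !bilinZl Ha Hb; ring.
elim/freeg_span: x' => [|c a b Ha Hb|i'].
- by rewrite bilin0r /tens linear0 bilin0r mul0r.
- rewrite tensDl tensZl !bilinDr !bilinZr Ha Hb; ring.
elim/freeg_span: y' => [|c a b Ha Hb|j'].
- by rewrite bilin0r linear0 bilin0r mulr0.
- rewrite tensDr tensZr !bilinDr !bilinZr Ha Hb; ring.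
by rewrite !tensU !bilinU.
Qed.
End Bilin.

(** * q-numbers and q-factorials *)
Section QNum.
Context (R : realType) (eta : R[i]).
Context (eta_gt0 : 0 < complex.Im eta).
Implicit Types I J : choiceType.
Local Notation C := R[i].
Local Notation q := (qpow eta 1).
Local Notation qp := (qpow eta).
Local Notation "[[ x ]]" := (qnum eta x).

(** Because |exp z| = exp (Re z). *)
Lemma cexp_eq1_Re (z : C) : cexp z = 1 -> complex.Re z = 0.
Proof.
case: z => x y /= /eqP; rewrite eq_complex /= => /andP[/eqP c1 /eqP s0].
have : expR (x + x) = 1.
  have : (expR x * cos y) ^+ 2 + (expR x * sin y) ^+ 2 = 1.
    by rewrite c1 s0 expr1n expr0n addr0.
  by rewrite !exprMn -mulrDr cos2Dsin2 mulr1 expRD expr2.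
rewrite -expR0 => /expR_inj xx; lra.
Qed.

(** Here Im eta > 0 enters: pi i eta k has real part - pi k Im eta, which is
    negative, so q is not a root of unity and all [k]! are invertible. *)
Lemma qpow_nat_neq1 (k : nat) : (0 < k)%N -> qp k%:R != 1.
Proof.
move=> k0; apply/eqP => /cexp_eq1_Re.
have -> : k%:R = (k%:R : R)%:C%C :> C by rewrite rmorph_nat.
rewrite -mulrA -mulrA; case: eta eta_gt0 => a b /= b0.
simpc => /= /eqP; rewrite oppr_eq0 !mulf_eq0 pnatr_eq0.
by rewrite !gt_eqF ?pi_gt0.
Qed.

Lemma qpow_sub_opp_neq0 (k : nat) : (0 < k)%N -> qp k%:R - qp (- k%:R) != 0.
Proof.
move=> k0; rewrite subr_eq0; apply/eqP => e.
have : qp (k + k)%:R = 1 by rewrite natrD qpowD {2}e mulrC qpowNK.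
by apply/eqP/qpow_nat_neq1; rewrite addn_gt0 k0.
Qed.

Lemma qpow1_subV_neq0 : q - q^-1 != 0.
Proof. by have := qpow_sub_opp_neq0 (ltn0Sn 0); rewrite qpowN. Qed.

Lemma qnum_nat_neq0 (k : nat) : (0 < k)%N -> [[ k%:R ]] != 0.
Proof.
by move=> k0; rewrite mulf_neq0 ?invr_neq0 ?qpow1_subV_neq0 ?qpow_sub_opp_neq0.
Qed.

Lemma qnum1 : [[ 1 ]] = 1.
Proof. by rewrite /qnum qpowN divff // qpow1_subV_neq0. Qed.

Lemma qnumN x : [[ - x ]] = - [[ x ]].
Proof. by rewrite /qnum opprK -opprB mulNr. Qed.

Lemma qnumD x y : [[ x + y ]] = qp x * [[ y ]] + qp (- y) * [[ x ]].
Proof. by rewrite /qnum !mulrA -mulrDl opprD !qpowD; congr (_ / _); ring. Qed.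

Lemma qfactS k : qfact eta k.+1 = qfact eta k * [[ k.+1%:R ]].
Proof. by rewrite /qfact big_nat_recr. Qed.

Lemma qfact0 : qfact eta 0 = 1.
Proof. by rewrite /qfact big_geq. Qed.

Lemma qfact_neq0 k : qfact eta k != 0.
Proof.
by elim: k => [|k IH]; rewrite ?qfact0 ?oner_eq0 // qfactS mulf_neq0 ?qnum_nat_neq0.
Qed.

Lemma qpochS x k : qpoch eta x k.+1 = qpoch eta x k * [[ x + k%:R ]].
Proof. by rewrite /qpoch big_ord_recr. Qed.

Lemma qpoch0 x : qpoch eta x 0 = 1.
Proof. by rewrite /qpoch big_ord0. Qed.

Lemma qpochSl x k : qpoch eta x k.+1 = [[ x ]] * qpoch eta (x + 1) k.
Proof.
rewrite /qpoch big_ord_recl addr0; congr (_ * _); apply: eq_bigr => i _.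
by rewrite /= /bump /= natrD addrA.
Qed.

Lemma qpochN x k : qpoch eta (- x) k = (-1) ^+ k * qpoch eta (x - k%:R + 1) k.
Proof.
elim: k => [|k IH]; first by rewrite !qpoch0 mulr1.
rewrite qpochS qpochSl IH exprS -(natr1 k).
have -> : x - (k%:R + 1) + 1 = x - k%:R by ring.
have -> : - x + k%:R = - (x - k%:R) by ring.
rewrite qnumN; ring.
Qed.

(** * The q-Chu-Vandermonde identity *)

(** The divided power [x]_k / [k]!: in terms of it the Vandermonde sum needs no
    q-binomial coefficients. *)
Definition qpoch_div x k := qpoch eta x k / qfact eta k.

Lemma qpoch_divS x k : [[ k.+1%:R ]] * qpoch_div x k.+1 = [[ x + k%:R ]] * qpoch_div x k.
Proof.
rewrite /qpoch_div qpochS qfactS; have := qfact_neq0 k; have := qnum_nat_neq0 (ltn0Sn k).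
by move=> a b; field; rewrite a b.
Qed.

(** Induction on m.  The identity for m is multiplied by
    [a + b + m] = q^{a + m - i} [b + i] + q^{-(b + i)} [a + m - i] in its i-th
    term, and the identity for m + 1 by
    [m + 1] = q^{-i} [m + 1 - i] + q^{m + 1 - i} [i]; the two sums of split terms
    agree after shifting the index in one of the halves. *)
Lemma q_vandermonde a b m :
  \sum_(i < m.+1) qp (i%:R * a - (m - i)%:R * b) *
     (qpoch_div a (m - i) * qpoch_div b i) = qpoch_div (a + b) m.
Proof.
elim: m => [|m IH].
  by rewrite big_ord1 /= !mul0r subrr qpow0 /qpoch_div !qpoch0 qfact0 divr1 !mulr1.
apply: (mulfI (qnum_nat_neq0 (ltn0Sn m))); rewrite qpoch_divS -IH !mulr_sumr.
(* U vanishes at i = m + 1 and V at i = 0; U_i and V_{i+1} are matched with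
   the two halves of the i-th term of the sum for m. *)
pose T i := qp (i%:R * a - (m.+1 - i)%:R * b) * (qpoch_div a (m.+1 - i) * qpoch_div b i).
pose U i := qp (- i%:R) * [[ (m.+1 - i)%:R ]] * T i.
pose V i := qp (m.+1 - i)%:R * [[ i%:R ]] * T i.
transitivity (\sum_(i < m.+2) (U i + V i)).
  apply: eq_bigr => i _; rewrite /U /V -mulrDl -/(T i); congr (_ * _).
  by rewrite [RHS]addrC -qnumD -natrD subnK // -ltnS.
rewrite big_split /= [X in X + _]big_ord_recr [X in _ + X]big_ord_recl /=.
rewrite {2}/U subnn qnum0 {1}/V qnum0 !(mulr0, mul0r, addr0, add0r) -big_split.
apply: eq_bigr => -[i /= im] _; rewrite /bump /= add1n /U /V /T subSS.
rewrite subSn //; set k := (m - i)%N.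
have -> : a + b + m%:R = (a + k%:R) + (b + i%:R).
  by rewrite -[m in LHS](subnK (im : (i <= m)%N)) natrD; ring.
rewrite qnumD mulrDl addrC; congr (_ + _).
  rewrite (_ : qp _ * _ * _ = qp k%:R * qp (i.+1%:R * a - k%:R * b) *
    (qpoch_div a k * ([[i.+1%:R]] * qpoch_div b i.+1))); last by ring.
  rewrite qpoch_divS -qpowD -natr1.
  have -> : k%:R + ((i%:R + 1) * a - k%:R * b) =
      (a + k%:R) + (i%:R * a - k%:R * b) by ring.
  by rewrite qpowD; ring.
rewrite (_ : qp _ * _ * _ = qp (- i%:R) * qp (i%:R * a - k.+1%:R * b) *
    (([[k.+1%:R]] * qpoch_div a k.+1) * qpoch_div b i)); last by ring.
rewrite qpoch_divS -qpowD -natr1.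
have -> : - i%:R + (i%:R * a - (k%:R + 1) * b) =
    - (b + i%:R) + (i%:R * a - k%:R * b) by ring.
by rewrite qpowD; ring.
Qed.

(** * Contravariant forms *)
(** The adjoint of F is q^{-h} E.  Self-adjointness of q^{-h} and the
    normalisation of q^{0h}, which the defining relations leave open, make the
    notion stable under tensor products. *)
Record contravariant I (A : uqmod eta I) (g : I -> I -> C) : Prop := {
  actK0 : forall x, actK A 0 x = x;
  gram_sym : forall i j, g i j = g j i;
  adjF : forall x y, bilin g (actF A x) y = bilin g x (actK A (-1) (actE A y));
  adjK : forall x y, bilin g (actK A (-1) x) y = bilin g x (actK A (-1) y) }.

Lemma bilin_sym I (g : I -> I -> C) x y :
  (forall i j, g i j = g j i) -> bilin g x y = bilin g y x.
Proof.
by move=> gs; rewrite bilinC; congr bilin; apply/funext => i; apply/funext.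
Qed.

Lemma adjFr I (A : uqmod eta I) g : contravariant A g -> forall x y,
  bilin g x (actF A y) = bilin g (actK A (-1) (actE A x)) y.
Proof. by move=> [_ gs aF _] x y; rewrite bilin_sym // aF bilin_sym. Qed.

Lemma bilin_adj I (g : I -> I -> C)
    (f f' : {linear {freeg I / C} -> {freeg I / C}}) :
  (forall i j, bilin g (f << i >>) << j >> = bilin g << i >> (f' << j >>)) ->
  forall x y, bilin g (f x) y = bilin g x (f' y).
Proof.
move=> fg x y; rewrite -[RHS]mul1r.
apply: (bilin_eq_basis (f1 := f) (f2 := id) (f3 := id) (f4 := f')) => //;
  try exact: linearP.
by move=> i j; rewrite mul1r.
Qed.

Lemma prod_qnum_recr l k : \prod_(1 <= i < k.+2) [[ l - i%:R + 1 ]] =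
  \prod_(1 <= i < k.+1) [[ l - i%:R + 1 ]] * [[ l - k%:R ]].
Proof. rewrite big_nat_recr //=; congr (_ * [[ _ ]]); rewrite -natr1; ring. Qed.

Lemma gram_verma_sym l i j : gram_verma eta l i j = gram_verma eta l j i.
Proof. by rewrite /gram_verma eq_sym; case: eqP => [->|] //; rewrite !mul0r. Qed.

Lemma gram_dual_sym l i j : gram_dual eta l i j = gram_dual eta l j i.
Proof. by rewrite /gram_dual eq_sym; case: eqP => [->|] //; rewrite !mul0r. Qed.

Lemma gram_verma_recr l k :
  [[k.+1%:R]] * gram_verma eta l k.+1 k.+1 =
  [[l - k%:R]] * qp (- wt l k) * gram_verma eta l k k.
Proof.
rewrite /gram_verma !eqxx !mul1r prod_qnum_recr qfactS.
have -> : - (k.+1%:R * (l - k.+1%:R + 1)) = - wt l k + - (k%:R * (l - k%:R + 1)).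
  by rewrite /wt -natr1; ring.
rewrite qpowD; have := qfact_neq0 k; have := qnum_nat_neq0 (ltn0Sn k).
by move=> a b; field; rewrite a b.
Qed.

Lemma gram_dual_recr l k :
  [[l - k%:R]] != 0 ->
  \prod_(1 <= i < k.+1) [[ l - i%:R + 1 ]] != 0 ->
  [[l - k%:R]] * gram_dual eta l k.+1 k.+1 =
  [[k.+1%:R]] * qp (- wt l k) * gram_dual eta l k k.
Proof.
rewrite /gram_dual !eqxx !mul1r prod_qnum_recr qfactS => a b.
have -> : - (k.+1%:R * (l - k.+1%:R + 1)) = - wt l k + - (k%:R * (l - k%:R + 1)).
  by rewrite /wt -natr1; ring.
by rewrite qpowD; field; rewrite a b.
Qed.

Lemma wtK0 I (w : I -> C) v : wtK eta w 0 v = v.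
Proof.
apply: (freeg_lin_ext (g := idfun)) => i /=.
by rewrite fgliftU1 mulr0 qpow0 scale1r.
Qed.

Lemma verma_contravariant l : contravariant (verma eta l) (gram_verma eta l).
Proof.
have dg i j : i != j -> gram_verma eta l i j = 0.
  by move=> /negbTE ij; rewrite /gram_verma ij mul0r.
split; [exact: wtK0|exact: gram_verma_sym|..].
- apply: (bilin_adj (f := actF (verma eta l))
    (f' := actK (verma eta l) (-1) \o actE (verma eta l))) => i [|j] /=.
    by rewrite !fgliftU1 linear0 bilin0r bilinZl bilinU dg // !mulr0.
  rewrite !fgliftU1 linearZ /= fgliftU1 bilinZl !bilinZr !bilinU.
  have [->|ij] := eqVneq i j; last by rewrite !dg // !mulr0.
  rewrite gram_verma_recr mulrN1 mulrA; congr ([[ _ ]] * _ * _).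
  by rewrite -natr1; ring.
- apply: (bilin_adj (f := actK (verma eta l) (-1))
    (f' := actK (verma eta l) (-1))) => i j /=.
  rewrite !fgliftU1 bilinZl !bilinZr !bilinU.
  by have [->|ij] := eqVneq i j; last by rewrite !dg // !mulr0.
Qed.

(** The norms of the u_m have the numbers [l - k] in the denominator; their
    being nonzero is all that is asked of a generic Lambda. *)
Lemma dual_contravariant l : (forall k : nat, [[l - k%:R]] != 0) ->
  contravariant (dualverma eta l) (gram_dual eta l).
Proof.
move=> l0.
have dg i j : i != j -> gram_dual eta l i j = 0.
  by move=> /negbTE ij; rewrite /gram_dual ij mul0r.
have p0 k : \prod_(1 <= i < k.+1) [[ l - i%:R + 1 ]] != 0.
  elim: k => [|k IH]; first by rewrite big_geq ?oner_eq0.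
  by rewrite prod_qnum_recr mulf_neq0.
split; [exact: wtK0|exact: gram_dual_sym|..].
- apply: (bilin_adj (f := actF (dualverma eta l))
    (f' := actK (dualverma eta l) (-1) \o actE (dualverma eta l))) => i [|j] /=.
    by rewrite !fgliftU1 qnum0 scale0r linear0 bilin0r bilinZl bilinU dg // !mulr0.
  rewrite !fgliftU1 linearZ /= fgliftU1 bilinZl !bilinZr !bilinU.
  have [->|ij] := eqVneq i j; last by rewrite !dg // !mulr0.
  by rewrite gram_dual_recr // mulrN1 mulrA.
- apply: (bilin_adj (f := actK (dualverma eta l) (-1))
    (f' := actK (dualverma eta l) (-1))) => i j /=.
  rewrite !fgliftU1 bilinZl !bilinZr !bilinU.
  by have [->|ij] := eqVneq i j; last by rewrite !dg // !mulr0.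
Qed.

(** The terms of Delta F = F (x) q^{-h} + 1 (x) F have as adjoints those of
    Delta (q^{-h} E) = q^{-h} E (x) q^{-h} + 1 (x) q^{-h} E; the second one is
    q^{-h} q^h (x) q^{-h} E, which is where q^{0h} = 1 is used. *)
Lemma tensor_contravariant I J (A : uqmod eta I) (B : uqmod eta J) g h :
  contravariant A g -> contravariant B h ->
  contravariant (tensor A B) (gram_tens g h).
Proof.
move=> [g0 gs gF gK] [h0 hs hF hK]; split.
- move=> x; apply: (freeg_lin_ext (f := actK (tensor A B) 0) (g := idfun)).
  by move=> [i j] /=; rewrite -tensU -[LHS]/(tensK A B 0 _) tensKt g0 h0.
- by move=> i j; rewrite /gram_tens gs hs.
- apply: (bilin_adj (f := actF (tensor A B))
    (f' := actK (tensor A B) (-1) \o actE (tensor A B))) => -[i j] [i' j'].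
  rewrite -!tensU -[LHS]/(bilin _ (tensF A B _) _).
  rewrite -[RHS]/(bilin _ _ (tensK A B (-1) (tensE A B _))).
  rewrite tensFt tensEt linearD !tensKt !actKK addNr.
  by rewrite bilinDl bilinDr !bilin_tens gF hK hF g0.
- apply: (bilin_adj (f := actK (tensor A B) (-1))
    (f' := actK (tensor A B) (-1))) => -[i j] [i' j'].
  rewrite -!tensU -[LHS]/(bilin _ (tensK A B _ _) _).
  rewrite -[RHS]/(bilin _ _ (tensK A B _ _)) !tensKt.
  by rewrite !bilin_tens gK hK.
Qed.

(** * Module maps out of a Verma module *)
Section VermaUniversal.
Context (I : choiceType) (A : uqmod eta I) (l : C) (w : {freeg I / C}).
Context (Ew : actE A w = 0) (Kw : forall x, actK A x w = qp (l * x) *: w).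

Lemma actK_iterF x k :
  actK A x (iter k (actF A) w) = qp (wt l k * x) *: iter k (actF A) w.
Proof.
elim: k => [|k IH]; first by rewrite /wt mulr0 subr0 Kw.
rewrite iterS actKF IH [actF A _]linearZ /= scalerA -qpowD; congr (qp _ *: _).
by rewrite /wt -natr1; ring.
Qed.

(** E F^{k+1} w is a sum of commutators, and [k+1] [l-k] has the increments
    [l - 2k] by [qnum_comm]. *)
Lemma actE_iterF k :
  actE A (iter k.+1 (actF A) w) = ([[k.+1%:R]] * [[l - k%:R]]) *: iter k (actF A) w.
Proof.
have EF k' : actE A (iter k'.+1 (actF A) w) =
    actF A (actE A (iter k' (actF A) w)) + [[l - k'%:R *+ 2]] *: iter k' (actF A) w.
  apply/eqP; rewrite addrC -subr_eq /= actEF !actK_iterF -scalerBl scalerA.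
  by rewrite mulr1 mulrN1 /wt mulr_natl mulrC.
elim: k => [|k IH].
  by rewrite EF /= Ew linear0 add0r mul0rn qnum1 mul1r.
rewrite EF IH linearZ /= -iterS -scalerDl; congr (_ *: _).
have -> : [[l - k%:R]] = [[l - k.+1%:R + 1]] by rewrite -natr1; congr [[ _ ]]; ring.
by rewrite -qnum_comm natr1 addrC subrK.
Qed.

(** The universal property of the Verma module: its basis vector of index k is
    F^k / [k]! applied to the highest weight vector. *)
Definition verma_lift : {linear {freeg nat / C} -> {freeg I / C}} :=
  fglift (fun k => (qfact eta k)^-1 *: iter k (actF A) w).

Lemma verma_lift_hom : uq_hom (verma eta l) A verma_lift.
Proof.
split; first exact: linearP.
- apply: (freeg_lin_ext (f := verma_lift \o actE (verma eta l))
    (g := actE A \o verma_lift)) => -[|k] /=; rewrite !fgliftU1 linearZ /=.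
    by rewrite Ew scaler0 linear0.
  rewrite linearZ /= fgliftU1 -[actF A _]/(iter k.+1 (actF A) w) actE_iterF !scalerA.
  congr (_ *: _).
  have -> : l - k.+1%:R + 1 = l - k%:R by rewrite -natr1; ring.
  rewrite qfactS; have := qfact_neq0 k; have := qnum_nat_neq0 (ltn0Sn k).
  by move=> a b; field; rewrite a b.
- apply: (freeg_lin_ext (f := verma_lift \o actF (verma eta l))
    (g := actF A \o verma_lift)) => k /=; rewrite !fgliftU1 !linearZ /= fgliftU1.
  rewrite scalerA -iterS qfactS; congr (_ *: _).
  have := qfact_neq0 k; have := qnum_nat_neq0 (ltn0Sn k).
  by move=> a b; field; rewrite a b.
- move=> x; apply: (freeg_lin_ext (f := verma_lift \o actK (verma eta l) x)
    (g := actK A x \o verma_lift)) => k /=; rewrite !fgliftU1 !linearZ /= fgliftU1.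
  by rewrite actK_iterF !scalerA mulrC.
Qed.

Lemma verma_lift_hw : verma_lift << 0%N >> = w.
Proof. by rewrite /verma_lift /= fgliftU1 qfact0 invr1 scale1r. Qed.

End VermaUniversal.

(** An operator F can be moved from one side to the other, where it becomes
    q^{-h} E and lowers the index.  This kills the pairing of basis vectors with
    different indices, since E kills highest weight vectors, and on the diagonal
    it is the recursion [gram_verma_recr].  The statement is not as
    asymmetric in l and l' as it looks: the first factor vanishes unless
    q^l = q^l', and then the forms of M_l and M_l' agree. *)
Lemma verma_hom_form I (A : uqmod eta I) g l l' f f' :
  contravariant A g -> uq_hom (verma eta l) A f -> uq_hom (verma eta l') A f' ->
  forall v v', bilin g (f v) (f' v') =
    bilin g (f << 0%N >>) (f' << 0%N >>) * bilin (gram_verma eta l') v v'.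
Proof.
move=> cg [fl fE fF fK] [fl' fE' fF' fK'].
apply: (bilin_eq_basis (f3 := id) (f4 := id)) => //.
have lin0 h : linear h -> h 0 = 0 :> {freeg I / C}.
  by move=> hl; have := hl (-1) 0 0; rewrite scaler0 addr0 scaleN1r addNr.
have linZ h c (x : {freeg nat / C}) : linear h -> h (c *: x) = c *: h x :> {freeg I / C}.
  by move=> hl; rewrite -[X in h X]addr0 hl lin0 // addr0.
have FU a (k : nat) : << k.+1 >> = [[k.+1%:R]]^-1 *: actF (verma eta a) << k >>.
  by rewrite /= fgliftU1 scalerA mulVf ?scale1r ?qnum_nat_neq0.
elim=> [|k IH] [|k'].
- by rewrite bilinU /gram_verma eqxx mul0r oppr0 qpow0 qfact0 big_geq // invr1 !mulr1.
- rewrite bilinU /gram_verma mul0r mulr0.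
  rewrite (FU l') linZ // bilinZr fF' (adjFr cg) -fE -fK.
  by rewrite (verma_hw _ _).1 linear0 lin0 // bilin0l mulr0.
- rewrite bilinU /gram_verma mul0r mulr0.
  rewrite (FU l) linZ // bilinZl fF (adjF cg) -fE' -fK'.
  by rewrite (verma_hw _ _).1 linear0 lin0 // bilin0r mulr0.
- rewrite [<< k.+1 >>](FU l) linZ // bilinZl fF (adjF cg) -fE' -fK'.
  rewrite /= fgliftU1 linearZ /= fgliftU1 linZ // linZ // !bilinZr IH !bilinU.
  rewrite fgliftU1 !bilinZl bilinU.
  have [<-|kk] := eqVneq k k'; last first.
    by rewrite /gram_verma eqSS (negbTE kk) !mul0r !mulr0.
  have -> : l' - k.+1%:R + 1 = l' - k%:R by rewrite -natr1; ring.
  by rewrite gram_verma_recr mulrN1; ring.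
Qed.

Lemma prod_qnum_poch x n :
  \prod_(1 <= k < n.+1) [[ x - k%:R + 1 ]] = qpoch eta (x - n%:R + 1) n.
Proof.
elim: n => [|n IH]; first by rewrite qpoch0 big_geq.
rewrite prod_qnum_recr IH qpochSl mulrC.
by congr ([[ _ ]] * qpoch _ _ _); rewrite -natr1; ring.
Qed.

Lemma qpochD x a b : qpoch eta x (a + b) = qpoch eta x a * qpoch eta (x + a%:R) b.
Proof.
elim: b => [|b IH]; first by rewrite addn0 qpoch0 mulr1.
by rewrite addnS !qpochS IH natrD addrA mulrA.
Qed.

(** * The intertwining operator for one tensor factor *)

(** Phi_m^L(l) v_{l-1} in terms of nu = l - L + 2m, where nu - 1 is the highest
    weight of the Verma factor in the target.  Operators with different l and m
    are compared exactly when they share nu. *)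
Definition intw_hw (L nu : C) (m : nat) : {freeg (nat * nat)%type / C} :=
  \sum_(i < m.+1) (qp (i%:R * (nu - i%:R)) * qpoch eta (- nu + i%:R + 1) (m - i)) *:
       tens << val i >> (iter i (actE (dualverma eta L)) << m >>).

Lemma iter_dualE L m i : (i <= m)%N ->
  iter i (actE (dualverma eta L)) << m >> =
  (qfact eta m / qfact eta (m - i)) *: << (m - i)%N >>.
Proof.
elim: i => [|i IH] im; first by rewrite subn0 divff ?qfact_neq0 // scale1r.
rewrite iterS IH ?(ltnW im) // linearZ /= fgliftU1 scalerA.
rewrite -(subnSK im) /= qfactS; congr (_ *: _).
have := qfact_neq0 (m - i.+1); have := qnum_nat_neq0 (ltn0Sn (m - i.+1)).
by move=> a b; field; rewrite a b.
Qed.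

(** Delta E = E (x) 1 + q^h (x) E, and the first summand at index i + 1 cancels
    the second one at index i. *)
Lemma actE_intw_hw L nu m :
  actE (tensor (verma eta (nu - 1)) (dualverma eta L)) (intw_hw L nu m) = 0.
Proof.
pose a i := qp (i%:R * (nu - i%:R)) * qpoch eta (- nu + i%:R + 1) (m - i).
pose u i : {freeg nat / C} := iter i (actE (dualverma eta L)) << m >>.
pose T i := a i *: tens (actE (verma eta (nu - 1)) << i >>) (u i).
pose U i := a i *: tens (actK (verma eta (nu - 1)) 1 << i >>) (u i.+1).
rewrite /intw_hw linear_sum; transitivity (\sum_(i < m.+1) (T i + U i)).
  apply: eq_bigr => i _; rewrite linearZ.
  rewrite -[LHS]/(a i *: tensE _ _ (tens _ _)).
  by rewrite tensEt scalerDr.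
rewrite big_split /= big_ord_recl [X in _ + X]big_ord_recr /=.
have -> : T 0%N = 0 by rewrite /T (verma_hw _ _).1 /tens linear0 scaler0.
have -> : U m = 0.
  rewrite /U (_ : u m.+1 = 0) ?linear0 ?scaler0 // /u iterS iter_dualE // subnn.
  by rewrite linearZ /= fgliftU1 qnum0 scale0r scaler0.
rewrite add0r addr0 -big_split big1 // => i _ /=.
rewrite /bump add1n /T /U /= !fgliftU1 !tensZl !scalerA -scalerDl.
rewrite [X in X *: _](_ : _ = 0) ?scale0r // /a.
rewrite -(subnSK (ltn_ord i)) qpochSl -natr1.
have -> : nu - 1 - (i%:R + 1) + 1 = - (- nu + i%:R + 1) by ring.
have -> : (i%:R + 1) * (nu - (i%:R + 1)) = i%:R * (nu - i%:R) + wt (nu - 1) i * 1.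
  by rewrite /wt; ring.
by rewrite qnumN qpowD -[_ + (_ + 1) + 1]addrA -!addrA; ring.
Qed.

Lemma actK_intw_hw L nu m x :
  actK (tensor (verma eta (nu - 1)) (dualverma eta L)) x (intw_hw L nu m) =
  qp ((nu + L - 2 * m%:R - 1) * x) *: intw_hw L nu m.
Proof.
rewrite /intw_hw linear_sum scaler_sumr; apply: eq_bigr => -[i /= im] _.
rewrite linearZ.
rewrite -[LHS]/(_ *: tensK (verma eta (nu - 1)) (dualverma eta L) x (tens _ _)).
rewrite tensKt.
rewrite iter_dualE // [actK _ x (_ *: _)]linearZ /= !fgliftU1.
rewrite tensZl !tensZr !scalerA; congr (_ *: _).
have -> : (nu + L - 2 * m%:R - 1) * x = wt (nu - 1) i * x + wt L (m - i) * x.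
  by rewrite /wt natrB //; ring.
by rewrite qpowD; ring.
Qed.

(** The vector [intw_hw] is singular of weight l - 1, hence the image of the
    highest weight vector under some module map, and the specification chosen
    from in [Phi1] is satisfiable. *)
Lemma Phi1_spec (L : C) (m : nat) (l nu : C) : l - L + 2 * m%:R = nu ->
  uq_hom (verma eta (l - 1)) (tensor (verma eta (nu - 1)) (dualverma eta L))
    (Phi1 eta L m l) /\ Phi1 eta L m l << 0%N >> = intw_hw L nu m.
Proof.
move=> <-; set nu' := l - L + 2 * m%:R.
have hw (f : {freeg nat / C} -> {freeg (nat * nat)%type / C}) :
  holo_intw_spec eta L m l f <-> uq_hom (verma eta (l - 1))
    (tensor (verma eta (nu' - 1)) (dualverma eta L)) f /\
    f << 0%N >> = intw_hw L nu' m.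
  rewrite /holo_intw_spec -/nu' /intw_hw.
  have -> : - l + L - 2 * m%:R = - nu' by rewrite /nu'; ring.
  by [].
apply/hw; rewrite /Phi1; apply: xgetPex.
have Ew := actE_intw_hw L nu' m.
have Kw x : actK (tensor (verma eta (nu' - 1)) (dualverma eta L)) x (intw_hw L nu' m)
  = qp ((l - 1) * x) *: intw_hw L nu' m.
  by rewrite actK_intw_hw; congr (qp (_ * x) *: _); rewrite /nu'; ring.
exists (verma_lift (tensor (verma eta (nu' - 1)) (dualverma eta L)) (intw_hw L nu' m) :
  {freeg nat / C} -> {freeg (nat * nat)%type / C}).
apply/hw; split; [exact: verma_lift_hom|exact: verma_lift_hw].
Qed.

(** The dynamical Shapovalov coefficient for n = 1. *)
Definition shapovalov1 (L : C) (m : nat) (l : C) : C :=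
  qfact eta m * \prod_(1 <= k < m.+1)
    ([[ l + k%:R ]] * [[ l - L + 2 * m%:R - k%:R ]] / [[ L - k%:R + 1 ]]).

(** Only equal indices (i, m - i) = (j, m' - j) contribute, and these force
    m = m'.  The remaining sum over i is, up to the factor
    [a]_m [m]!^2 / [b]_m, the Vandermonde sum with a = nu - m and b = L - m + 1,
    for which a + b - 1 is the parameter nu + L - 2m of the coefficient. *)
Lemma intw_hw_norm (L nu : C) (m m' : nat) : (forall k : nat, [[L - k%:R]] != 0) ->
  bilin (gram_tens (gram_verma eta (nu - 1)) (gram_dual eta L))
    (intw_hw L nu m) (intw_hw L nu m') =
  (m == m')%:R * shapovalov1 L m (nu + L - 2 * m%:R).
Proof.
move=> L0.
pose c i n := qp (i%:R * (nu - i%:R)) * qpoch eta (- nu + i%:R + 1) (n - i) *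
  (qfact eta n / qfact eta (n - i)).
have hwE n : intw_hw L nu n = \sum_(i < n.+1) c i n *: << (val i, (n - i)%N) >>.
  apply: eq_bigr => -[i /= im] _.
  by rewrite iter_dualE // tensZr scalerA tensU.
rewrite !hwE bilin_suml.
have termE (i : 'I_m.+1) :
  bilin (gram_tens (gram_verma eta (nu - 1)) (gram_dual eta L))
    (c i m *: << (val i, (m - i)%N) >>)
    (\sum_(i0 < m'.+1) c i0 m' *: <<(\val i0, (m' - i0)%N)>>) =
   (m == m')%:R * (c i m ^+ 2 *
      (gram_verma eta (nu - 1) i i * gram_dual eta L (m - i) (m - i))).
  case: i => i /= im.
  have t0 (j : 'I_m'.+1) : (i != j) || (m != m') ->
      gram_tens (gram_verma eta (nu - 1)) (gram_dual eta L)
        (i, (m - i)%N) (val j, (m' - j)%N) = 0.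
    case: j => j /= jm ij; rewrite /gram_tens /gram_verma /gram_dual /=.
    case: eqP => [eij|]; last by rewrite !mul0r.
    rewrite eij eqxx /= in ij; rewrite -eij.
    case: eqP => [emm|]; last by rewrite !mul0r mulr0.
    by move: ij; rewrite -(subnK (im : (i <= m)%N)) emm subnK ?eqxx // eij.
  rewrite bilinZl bilin_sumr.
  have [mm|mm] := eqVneq m m'; last first.
    rewrite mul0r big1 ?mulr0 // => j _.
    by rewrite bilinZr bilinU t0 ?mulr0 // mm orbT.
  have im' : (i < m'.+1)%N by rewrite -mm.
  rewrite (bigD1 (Ordinal im')) //= big1 ?addr0 => [|j ji].
    by rewrite bilinZr bilinU /gram_tens /= -mm mul1r; ring.
  rewrite bilinZr bilinU t0 ?mulr0 //; apply/orP; left.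
  by apply: contraNneq ji => ij; apply/eqP/val_inj.
rewrite (eq_bigr _ (fun i _ => termE i)) -mulr_sumr; congr (_ * _).
(* A m = [a]_m and S m = [b]_m, which split as A (m - i) and B i times the
   products that occur in the norms of v^(i) and u_(m - i). *)
pose A n := qpoch eta (nu - m%:R) n.
pose B n := qpoch eta (L - m%:R + 1) n.
pose S n := qpoch eta (L - n%:R + 1) n.
have S0 n : S n != 0.
  rewrite /S -prod_qnum_poch; elim: n => [|n IH]; first by rewrite big_geq ?oner_eq0.
  by rewrite prod_qnum_recr mulf_neq0.
transitivity (A m * qfact eta m ^+ 2 / S m * qpoch_div ((nu - m%:R) + (L - m%:R + 1)) m).
  rewrite -q_vandermonde mulr_sumr; apply: eq_bigr => -[i /= im] _.
  rewrite /gram_verma /gram_dual !eqxx !mul1r !prod_qnum_poch.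
  rewrite /qpoch_div -/(A _) -/(B _) -/(S _).
  have -> : A m = A (m - i)%N * qpoch eta (nu - 1 - i%:R + 1) i.
    rewrite /A -{2}(subnK (im : (i <= m)%N)) qpochD natrB //.
    by congr (_ * qpoch _ _ _); ring.
  have SB : S m = B i * S (m - i)%N.
    rewrite /S /B -{2}(subnKC (im : (i <= m)%N)) qpochD natrB //.
    by congr (_ * qpoch _ _ _); ring.
  have := S0 m; rewrite SB mulf_eq0 negb_or => /andP[b0 s0].
  rewrite /c.
  have -> : - nu + i%:R + 1 = - (nu - i%:R - 1) by ring.
  rewrite qpochN.
  have -> : nu - i%:R - 1 - (m - i)%:R + 1 = nu - m%:R by rewrite natrB //; ring.
  rewrite -/(A _).
  have -> : i%:R * (nu - m%:R) - (m - i)%:R * (L - m%:R + 1) =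
    i%:R * (nu - i%:R) + i%:R * (nu - i%:R) + - (i%:R * (nu - 1 - i%:R + 1)) +
      - ((m - i)%:R * (L - (m - i)%:R + 1)) :> C.
    by rewrite natrB //; ring.
  rewrite !qpowD.
  (* Reversing [-nu + i + 1]_(m - i) costs a sign, which the square removes. *)
  have sq : (-1) ^+ (m - i) * (-1) ^+ (m - i) = 1 :> C by rewrite -expr2 sqrr_sign.
  have := qfact_neq0 i; have := qfact_neq0 (m - i)%N.
  move: (qpoch eta (nu - 1 - i%:R + 1) i) (qfact eta i) (qfact eta (m - i)).
  move=> P f1 f2 f20 f10.
  rewrite !exprMn [((-1) ^+ _) ^+ 2]expr2 sq.
  by field; rewrite f10 f20 b0 s0.
rewrite /shapovalov1 /qpoch_div.
have prodE (x y z : nat -> C) : \prod_(1 <= k < m.+1) (x k * y k / z k) =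
    \prod_(1 <= k < m.+1) x k * \prod_(1 <= k < m.+1) y k / \prod_(1 <= k < m.+1) z k.
  by rewrite -prodfV -!big_split.
rewrite prodE prod_qnum_poch -/(S m).
have -> : \prod_(1 <= k < m.+1) [[ nu + L - 2 * m%:R + k%:R ]] =
    qpoch eta (nu - m%:R + (L - m%:R + 1)) m.
  rewrite big_add1 /= big_mkord; apply: eq_bigr => i _; congr [[ _ ]].
  by rewrite -natr1; ring.
have -> : \prod_(1 <= k < m.+1) [[ nu + L - 2 * m%:R - L + 2 * m%:R - k%:R ]] = A m.
  rewrite /A; have -> : nu - m%:R = nu - 1 - m%:R + 1 by ring.
  by rewrite -prod_qnum_poch; apply: eq_bigr => k _; congr [[ _ ]]; ring.
by field; rewrite S0 qfact_neq0.
Qed.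

(** * Compositions of intertwining operators *)
(** Removing the last factor shifts every s_j by L_n - 2 m_n, which is absorbed
    by shifting l, while s_n = 0. *)
Lemma dyn_shapovalov_recr n (L : 'I_n.+1 -> C) (m : 'I_n.+1 -> nat) l :
  dyn_shapovalov eta L m l =
  dyn_shapovalov eta (initf L) (initf m) (l - L ord_max + 2 * (m ord_max)%:R) *
  shapovalov1 (L ord_max) (m ord_max) l.
Proof.
rewrite /dyn_shapovalov big_ord_recr /=; congr (_ * _); last first.
  rewrite [\sum_(i < _ | _) _]big1 ?subr0 // => i.
  by rewrite ltnNge -ltnS ltn_ord.
apply: eq_bigr => j _.
rewrite [X in l - X]big_mkcond big_ord_recr /= ltn_ord -big_mkcond /=.
rewrite /initf; set s := \sum_(i < n | _) _.
have -> : l - (s + (L ord_max - 2 * (m ord_max)%:R)) =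
  l - L ord_max + 2 * (m ord_max)%:R - s by ring.
by [].
Qed.

Lemma forall_ord_recr n (P : pred 'I_n.+1) :
  [forall i, P i] = [forall i, initf P i] && P ord_max.
Proof.
apply/forallP/andP => [Pi|[/forallP Pi Pn] i].
  by split; [apply/forallP => i|]; apply: Pi.
have [j ->|->] := @unliftP _ ord_max i; last by [].
suff -> : fintype.lift ord_max j = widen_ord (leqnSn n) j by exact: Pi.
exact/val_inj/lift_max.
Qed.

(** Induction on n by splitting off the last tensor factor.  By induction
    Phi' (x) 1 multiplies the form by a scalar, which is zero unless m and m'
    agree on the first n indices; if they do, the two operators for the last
    index have the same target and [verma_hom_form] and [intw_hw_norm] apply. *)
Lemma Phi_form n (mu : C) (L : 'I_n -> C) (m m' : 'I_n -> nat) :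
  (forall j (k : nat), [[ L j - k%:R ]] != 0) ->
  let lam := mu + \sum_(i < n) (L i - 2 * (m i)%:R) in
  let lam' := mu + \sum_(i < n) (L i - 2 * (m' i)%:R) in
  forall v v',
  bilin (gram_prod eta (mu - 1) L) (Phi eta L m lam v) (Phi eta L m' lam' v') =
     [forall j, m j == m' j]%:R * dyn_shapovalov eta L m lam *
     bilin (gram_verma eta (lam - 1)) v v'.
Proof.
elim: n L m m' => [|n IH] L m m' L0 lam lam' v v'.
  rewrite /lam /= big_ord0 addr0 /dyn_shapovalov big_ord0.
  have -> : [forall j, m j == m' j] by apply/forallP; case.
  by rewrite !mul1r.
have {}IH := IH (initf L) (initf m) (initf m') (fun j => L0 _).
set lm := L ord_max; set nu := mu + \sum_(i < n) (initf L i - 2 * (initf m i)%:R) in IH.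
set nu' := mu + \sum_(i < n) (initf L i - 2 * (initf m' i)%:R) in IH.
have lamE : lam - lm + 2 * (m ord_max)%:R = nu.
  by rewrite /lam big_ord_recr /= /nu -/lm /initf; ring.
have lamE' : lam' - lm + 2 * (m' ord_max)%:R = nu'.
  by rewrite /lam' big_ord_recr /= /nu' -/lm /initf; ring.
rewrite dyn_shapovalov_recr forall_ord_recr /= -/lm lamE lamE'.
pose h := gram_tens (gram_verma eta (nu - 1)) (gram_dual eta lm).
have stepE w w' :
  bilin (gram_tens (gram_prod eta (mu - 1) (initf L)) (gram_dual eta lm))
   (tensmap (Phi eta (initf L) (initf m) nu) idfun w)
   (tensmap (Phi eta (initf L) (initf m') nu') idfun w') =
   ([forall j, initf m j == initf m' j]%:R *
      dyn_shapovalov eta (initf L) (initf m) nu) *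
   bilin h w w'.
  apply: (bilin_eq_basis (f3 := id) (f4 := id)) => //; try exact: linearP.
  move=> [i j] [i' j']; rewrite /tensmap !fgliftU1 /= bilin_tens IH.
  by rewrite !bilinU /h /gram_tens /= !mulrA.
rewrite stepE.
rewrite -[ [forall i, initf _ i] ]/([forall j, initf m j == initf m' j]).
have [mm|_] := boolP [forall j, initf m j == initf m' j]; last by rewrite !mul0r.
move/forallP in mm.
rewrite /= !mul1r.
have nuE : nu' = nu.
  by congr (_ + _); apply: eq_bigr => i _; rewrite (eqP (mm i)).
rewrite nuE in lamE'; clearbody lam lam' nu.
have [hom hw] := Phi1_spec lamE; have [hom' hw'] := Phi1_spec lamE'.
rewrite (verma_hom_form (tensor_contravariant (verma_contravariant (nu - 1))
   (dual_contravariant (L0 ord_max))) hom hom') hw hw' intw_hw_norm //.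
have [e|] := eqVneq; last by rewrite !mul0r mulr0.
have -> : nu + L ord_max - 2 * (m ord_max)%:R = lam by rewrite -/lm -lamE; ring.
have -> : lam' = lam.
  apply: (addIr (- lm + 2 * (m ord_max)%:R)).
  by rewrite !addrA lamE e lamE'.
by rewrite !mul1r mulrA.
Qed.

End QNum.

(** * Orthogonality for generic parameters *)

Lemma holomorphic_prod (R : realType) (n : nat) (J : Type) (r : seq J)
    (F : J -> 'rV[R[i]]_n -> R[i]) :
  (forall j, holomorphic (F j)) -> holomorphic (fun x => \prod_(j <- r) F j x).
Proof.
move=> hF; elim: r => [|j r IH] x.
  under eq_fun do rewrite big_nil.
  exact: differentiable_cst.
under eq_fun do rewrite big_cons.
exact: (differentiableM (hF j x) (IH x)).
Qed.

Lemma holomorphic_qnum (R : realType) (eta : R[i]) (n : nat) (j : 'I_n) b :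
  holomorphic (fun x : 'rV[R[i]]_n => qnum eta (x ord0 j - b)).
Proof.
move=> x; pose c := pi%:C%C * 'i%C * eta.
have -> : (fun x : 'rV[R[i]]_n => qnum eta (x ord0 j - b)) =
    (fun x => (cexp (c * x ord0 j + - (c * b)) - cexp (- c * x ord0 j + c * b))
              * (qpow eta 1 - (qpow eta 1)^-1)^-1).
  apply/funext => y; rewrite /qnum /qpow -/c.
  by congr ((cexp _ - cexp _) / _); ring.
apply: differentiableM; last exact: differentiable_cst.
by apply: differentiableB; apply: holomorphic_cexp.
Qed.

(** Taking the product over j leaves one function for each k, and Lambda_j = k + 1
    makes all its factors equal to [1] = 1. *)
Lemma generically_qnum_neq0 (R : realType) (eta : R[i]) (n : nat) :
  0 < complex.Im eta ->
  generically (fun L : 'rV[R[i]]_n =>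
    forall j (k : nat), qnum eta (L ord0 j - k%:R) != 0).
Proof.
move=> eta_gt0.
exists (fun k x => \prod_(j <- index_enum 'I_n) qnum eta (x ord0 j - k%:R)).
split=> [k|x fx j k].
  split; first by apply: holomorphic_prod => j; apply: holomorphic_qnum.
  exists (const_mx k.+1%:R); apply/eqP/prodf_neq0 => j _.
  by rewrite mxE -natr1 addrAC subrr add0r qnum1 // oner_eq0.
by have /eqP/prodf_neq0 := fx k; apply.
Qed.

Theorem theorem3p1 (R : realType) (eta : R[i]) (eta_gt0 : 0 < complex.Im eta)
    (n : nat) (mu : R[i]) (m m' : {ffun 'I_n -> nat}) :
  generically (fun Lambda : 'rV[R[i]]_n =>
    let L := Lambda ord0 in
    let lam : R[i] := mu + \sum_(i < n) (L i - 2 * (m i)%:R) in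
    let lam' : R[i] := mu + \sum_(i < n) (L i - 2 * (m' i)%:R) in
    forall v v' : {freeg nat / R[i]},
      bilin (gram_prod eta (mu - 1) L) (Phi eta L m lam v) (Phi eta L m' lam' v')
      = (m == m')%:R * dyn_shapovalov eta L m lam *
        bilin (gram_verma eta (lam - 1)) v v').
Proof.
have [f [hf fP]] := generically_qnum_neq0 n eta_gt0.
exists f; split=> // Lambda /fP L0 L lam lam' v v'.
rewrite (Phi_form eta_gt0 _ _ _ L0).
congr ((nat_of_bool _)%:R * _ * _).
by apply/forallP/eqP => [mm|-> //]; apply/ffunP => j; apply/eqP.
Qed.
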